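(* For $n \geq 4$, a connected graph $G$ of order $n$ has $\mathrm{vp}^-(G) = n-2$ and $\mathrm{vp}(G) = n-1$ if and only if (i) $G$ is isomorphic to a clique with a non-empty, non-perfect matching deleted, or (ii) $G$ is the join of $K_1$ with a disjoint union of cliques.
   Context: All graphs are finite, undirected and simple. $K_1$ is the one-vertex graph. The join of two graphs is their disjoint union together with all edges between them. A $u,v$-geodesic is a shortest $u,v$-path. For a vertex $x$ of $G$, a set $S \subseteq V(G)$ is an $x$-position set if for every $y \in S$ no vertex of $S \setminus \{y\}$ lies on any $x,y$-geodesic in $G$. The $x$-position number $p_x(G)$ is the maximum cardinality of an $x$-position set of $G$. Define $\mathrm{vp}(G) = \max_{x \in V(G)} p_x(G)$ and $\mathrm{vp}^-(G) = \min_{x \in V(G)} p_x(G)$.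
   Formalization: In (ii), the disjoint union of cliques is required to have at least two (non-empty) cliques; with a single clique the join with K_1 is the complete graph K_n, for which vp^-(G) = vp(G) = n-1, so the equivalence would fail. *)

(* Defs.v *)
From mathcomp Require Import all_boot.
From mathcomp Require Import boolp.

Set Implicit Arguments.
Unset Strict Implicit.
Unset Printing Implicit Defensive.

Record sgraph := SGraph {
  svertex :> finType;
  sedge : rel svertex;
  sedge_sym : symmetric sedge;
  sedge_irr : irreflexive sedge }.

Arguments sedge {G} x y : rename.

Definition connected (G : sgraph) : Prop :=
  forall x y : G, connect sedge x y.

Definition isomorphic (G H : sgraph) : Prop :=
  exists f : G -> H, bijective f /\ forall x y, sedge (f x) (f y) = sedge x y.

(* As in mathcomp's [path], a path is given by its first vertex x and the list
   p of its remaining vertices, so that its vertices are x :: p and its length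
   is size p. *)
Definition is_path (G : sgraph) (x y : G) (p : seq G) : Prop :=
  [/\ path sedge x p, last x p = y & uniq (x :: p)].

Definition geodesic (G : sgraph) (x y : G) (p : seq G) : Prop :=
  is_path x y p /\ forall q, is_path x y q -> size p <= size q.

Definition position_set (G : sgraph) (x : G) (S : {set G}) : Prop :=
  forall y p, y \in S -> geodesic x y p ->
  forall z, z \in S :\ y -> z \notin x :: p.

Definition position_number (G : sgraph) (x : G) : nat :=
  \max_(S : {set G} | `[< position_set x S >]) #|S|.

Definition vp (G : sgraph) : nat := \max_(x : G) position_number x.

(* Position numbers are at most #|G|, so for nonempty G the default value of
   the iterated minimum does not affect the result. *)
Definition vp_min (G : sgraph) : nat :=
  \big[minn/#|G|]_(x : G) position_number x.

Section Complete.
Variable n : nat.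

Definition complete_edge : rel 'I_n := fun x y => x != y.

Lemma complete_edge_sym : symmetric complete_edge.
Proof. by move=> x y; rewrite /complete_edge eq_sym. Qed.

Lemma complete_edge_irr : irreflexive complete_edge.
Proof. by move=> x; rewrite /complete_edge eqxx. Qed.

Definition complete : sgraph := SGraph complete_edge_sym complete_edge_irr.
End Complete.

Definition edge_set (G : sgraph) : {set {set G}} :=
  [set [set x; y] | x in G, y in G & sedge x y].

Definition matching (G : sgraph) (M : {set {set G}}) : Prop :=
  M \subset edge_set G /\ trivIset M.

Definition perfect_matching (G : sgraph) (M : {set {set G}}) : Prop :=
  matching M /\ cover M = [set: G].

Section DeleteEdges.
Variables (G : sgraph) (M : {set {set G}}).

Definition delete_edge : rel G :=
  fun x y => sedge x y && ([set x; y] \notin M).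

Lemma delete_edge_sym : symmetric delete_edge.
Proof. by move=> x y; rewrite /delete_edge sedge_sym setUC. Qed.

Lemma delete_edge_irr : irreflexive delete_edge.
Proof. by move=> x; rewrite /delete_edge sedge_irr. Qed.

Definition delete_edges : sgraph := SGraph delete_edge_sym delete_edge_irr.
End DeleteEdges.

Section DisjointUnion.
Variables (I : finType) (F : I -> sgraph).

Definition disjoint_union_edge : rel {i : I & F i} :=
  fun u v => (tag u == tag v) && sedge (tagged u) (tagged_as u v).

Lemma disjoint_union_edge_sym : symmetric disjoint_union_edge.
Proof.
case=> i x [j y]; rewrite /disjoint_union_edge /= eq_sym.
by case: eqP => //= ij; case: i / ij x => x; rewrite !tagged_asE sedge_sym.
Qed.

Lemma disjoint_union_edge_irr : irreflexive disjoint_union_edge.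
Proof.
by case=> i x; rewrite /disjoint_union_edge tagged_asE sedge_irr andbF.
Qed.

Definition disjoint_union : sgraph :=
  SGraph disjoint_union_edge_sym disjoint_union_edge_irr.
End DisjointUnion.

Section Join.
Variables G H : sgraph.

Definition join_edge : rel (G + H)%type := fun u v =>
  match u, v with
  | inl x, inl y => sedge x y
  | inr x, inr y => sedge x y
  | _, _ => true
  end.

Lemma join_edge_sym : symmetric join_edge.
Proof. by move=> [x|x] [y|y] //=; apply: sedge_sym. Qed.

Lemma join_edge_irr : irreflexive join_edge.
Proof. by move=> [x|x] /=; apply: sedge_irr. Qed.

Definition join : sgraph := SGraph join_edge_sym join_edge_irr.
End Join.

Definition clique_minus_matching (G : sgraph) : Prop :=
  exists (m : nat) (M : {set {set complete m}}),
    [/\ matching M, M <> set0, ~ perfect_matching M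
      & isomorphic G (delete_edges M)].

(* The union has at least two (nonempty) parts: joining K_1 to a single clique
   gives a complete graph, whose position numbers all equal its order minus
   one. *)
Definition join_K1_cliques (G : sgraph) : Prop :=
  exists (r : nat) (c : 'I_r -> nat),
    [/\ 1 < r, forall i, 0 < c i
      & isomorphic G
          (join (complete 1) (disjoint_union (fun i => complete (c i))))].

(* Main.v *)
Require Import Defs.
From mathcomp Require Import all_boot boolp.

Set Implicit Arguments.
Unset Strict Implicit.
Unset Printing Implicit Defensive.

(** A position set of size n - 1 at u forces u to be universal, and once a
    universal vertex u exists every geodesic has length at most 2.  For a
    non-universal x, omitting a single further vertex w from the complement of
    x leaves a position set only if either w is the unique non-neighbour of x,
    or w = u and no neighbour of x other than u is adjacent to a non-neighbour
    of x.  If some vertex has two non-neighbours, then it is of the second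
    kind, and this forces every vertex to be so: adjacency is transitive off u,
    that is, G - u is a disjoint union of cliques.  Otherwise the non-edges of
    G form a matching, which misses u. *)

(** * Iterated minima with a default value *)

Lemma bigmin_le (I : finType) (N : nat) (F : I -> nat) (i : I) :
  \big[minn/N]_(j : I) F j <= F i.
Proof.
have := mem_index_enum i; elim: (index_enum I) => // a s IHs.
rewrite inE big_cons => /orP[/eqP<-|/IHs]; first exact: geq_minl.
exact/leq_trans/geq_minr.
Qed.

(** The default [N] takes part in the minimum, so it can be the value even when [I] is nonempty. *)
Lemma bigmin_attained (I : finType) (N : nat) (F : I -> nat) :
  \big[minn/N]_(j : I) F j = N \/ exists i, \big[minn/N]_(j : I) F j = F i.
Proof.
elim/big_rec: _ => [|i m _ IHm]; first by left.
by rewrite /minn; case: ifP => // _; right; exists i.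
Qed.

Definition universal {G : sgraph} (u : G) : Prop :=
  forall y, y != u -> sedge u y.

(** Required at every vertex, this says that the non-edges form a matching. *)
Definition at_most_one_nonneighbour (G : sgraph) (x : G) : Prop :=
  forall y z, y != x -> z != x -> ~~ sedge x y -> ~~ sedge x z -> y = z.

(** For [x] other than [u]: the closed neighbourhood of [x] in G - u is its whole component
    there. *)
Definition no_path_to_nonneighbour_off {G : sgraph} (u x : G) : Prop :=
  forall a b, a != u -> b != u -> sedge x a -> sedge a b -> b != x ->
  sedge x b.

Section Graph.
Variable G : sgraph.
Implicit Types (x y z u a b : G) (S : {set G}) (p : seq G).

(** * Existence of geodesics, and geodesics of length at most two *)

Lemma sedge_neq x y : sedge x y -> x != y.
Proof. by apply: contraTneq => ->; rewrite sedge_irr. Qed.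

Lemma geodesic_exists x y : connected G -> exists p, geodesic x y p.
Proof.
move=> /(_ x y) /connectP[q xq yq].
have ex : exists k, `[< exists2 p, is_path x y p & size p = k >].
  case/shortenP: xq yq => p xp up _ ->.
  by exists (size p); apply/asboolP; exists p.
case: (ex_minnP ex) => m /asboolP[p pp <-] minp; exists p; split=> // q' pq'.
by apply: minp; apply/asboolP; exists q'.
Qed.

Lemma geodesic_edge x y p : sedge x y -> geodesic x y p -> p = [:: y].
Proof.
move=> xy [[_ lp _] minp].
have /minp : is_path x y [:: y] by split; rewrite /= ?xy ?inE ?sedge_neq.
case: p lp {minp} => [/= xE|a [|//]] /=; last by move=> ->.
by rewrite xE sedge_irr in xy.
Qed.

Lemma geodesic_two_edges x a y :
  sedge x a -> sedge a y -> x != y -> ~~ sedge x y ->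
  geodesic x y [:: a; y].
Proof.
move=> xa ay nxy nexy; split.
  split; rewrite //= ?xa ?ay // !inE negb_or.
  by rewrite (sedge_neq xa) (sedge_neq ay) nxy.
case=> [|b [|c q]] [] //= + + _; first by move=> _ xE; rewrite xE eqxx in nxy.
by move=> + by_; rewrite by_ andbT (negPf nexy).
Qed.

Lemma geodesic_nonadjacent x a y p :
  sedge x a -> sedge a y -> x != y -> ~~ sedge x y -> geodesic x y p ->
  exists b, [/\ sedge x b, sedge b y & p = [:: b; y]].
Proof.
move=> xa ay nxy nexy [[xp lp _]].
have [pay _] := geodesic_two_edges xa ay nxy nexy.
move=> /(_ _ pay); case: p xp lp => [|b [|c [|//]]] /=.
- by move=> _ xy; rewrite xy eqxx in nxy.
- by move=> + by_; rewrite by_ andbT (negPf nexy).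
- by move=> /and3P[xb bc _] <- _; exists b.
Qed.

(** * Position sets and position numbers *)

Lemma leq_position_number k x :
  k <= position_number x <-> exists2 S, position_set x S & k <= #|S|.
Proof.
split=> [|[S posS kS]]; last first.
  by apply: leq_trans kS _; apply: leq_bigmax_cond; apply/asboolP.
(* The empty set is always admissible, so the maximum is attained by some position set. *)
have ps0 : `[< position_set x set0 >].
  by apply/asboolP => y p; rewrite inE.
rewrite /position_number (bigop.bigmax_eq_arg set0) //.
by case: arg_maxnP => // S /asboolP posS _ kS; exists S.
Qed.

(** Every geodesic from [x] contains [x], so [x] in [S] would block any other element of [S]. The
    size bound excludes the position set [[set x]]. *)
Lemma position_set_notin x S :
  connected G -> position_set x S -> 1 < #|S| -> x \notin S.
Proof.
move=> cG posS S2; apply/negP => xS.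
have [y yS yx] : exists2 y, y \in S & y != x.
  move: S2; rewrite (cardsD1 x) xS ltnS => /card_gt0P[y].
  by rewrite !inE => /andP[]; exists y.
have [p xyp] := geodesic_exists x y cG.
by have := posS y p yS xyp x; rewrite !inE eqxx eq_sym yx xS => /(_ isT).
Qed.

Lemma position_set_compl1 x S :
  connected G -> 2 < #|G| -> position_set x S -> #|G|.-1 <= #|S| ->
  S = [set~ x].
Proof.
move=> cG G3 posS S_ge; apply/eqP; rewrite eqEcard cardsC1 S_ge andbT.
apply/subsetP => y yS; rewrite !inE; apply: contraTneq yS => ->.
apply: position_set_notin => //; apply: leq_trans S_ge.
by rewrite -ltnS prednK // (leq_trans _ G3).
Qed.

(** If only [u] is left out of [S], the second vertex of a geodesic from [u] to [y] is in [S], hence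
    equals [y]. Conversely, geodesics from a universal vertex to other vertices are single edges. *)
Lemma universal_position_number u :
  connected G -> 2 < #|G| ->
  #|G|.-1 <= position_number u <-> universal u.
Proof.
move=> cG G3; rewrite leq_position_number; split=> [[S posS S_ge] y yu|univ].
  have SE := position_set_compl1 cG G3 posS S_ge.
  have [[|a p] uyp] := geodesic_exists u y cG.
    by case: uyp => -[_ /= uy]; rewrite uy eqxx in yu.
  case: (uyp) => -[/= /andP[ua _] _ _] _.
  have [<- //|ay] := eqVneq a y.
  have := posS y (a :: p) _ uyp a; rewrite SE !inE yu ay eqxx orbT /=.
  by rewrite eq_sym sedge_neq // => /(_ isT isT).
exists [set~ u]; last by rewrite cardsC1.
move=> y p; rewrite !inE => yu /(geodesic_edge (univ y yu)) -> z.
by rewrite !inE negb_or => /andP[-> ->].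
Qed.

Lemma position_number_nonuniversal u x :
  connected G -> 3 < #|G| -> universal u -> ~ universal x ->
  #|G| - 2 <= position_number x <->
  at_most_one_nonneighbour x \/ no_path_to_nonneighbour_off u x.
Proof.
move=> cG G4 univ nunix.
have nxu : x != u by apply/eqP => xu; rewrite xu in nunix.
have xu : sedge x u by rewrite sedge_sym univ.
rewrite leq_position_number; split=> [[S posS S_ge]|].
- have xS : x \notin S.
    apply: position_set_notin => //; apply: leq_trans S_ge.
    by rewrite leq_subRL // (ltnW (ltnW G4)).
  have CS : #|~: (x |: S)| <= 1.
    by rewrite cardsCs setCK cardsU1 xS leq_subLR addn1 add1n -add2n -leq_subLR.
  (* With [u] in [S], the geodesic through [u] keeps every non-neighbour of [x] out of [S], where
     [CS] leaves room for only one. *)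
  have [uS|uS] := boolP (u \in S).
    have nonadjS y : y != x -> ~~ sedge x y -> y \in ~: (x |: S).
      move=> yx nexy; rewrite !inE negb_or yx; apply/negP => yS.
      have yu : y != u by apply: contraNneq nexy => ->.
      have := posS _ _ yS (geodesic_two_edges xu (univ y yu) _ nexy) u.
      rewrite eq_sym yx => /(_ isT).
      by rewrite !inE uS eqxx orbT eq_sym yu => /(_ isT).
    left=> y z yx zx nexy nexz.
    by apply: (card_le1_eqP CS); apply: nonadjS.
  (* Now [u] is the only vertex besides [x] missing from [S], so a geodesic from [x] to a
     non-neighbour [b] cannot pass through any other [a]. *)
  have inS a : a != x -> a != u -> a \in S.
    move=> ax au; apply: contraNT au => aS; apply/eqP.
    by apply: (card_le1_eqP CS); rewrite !inE negb_or ?ax // eq_sym nxu.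
  right=> a b au bu xa ab bx; apply/negPn/negP => nexb.
  have bS := inS b bx bu.
  have aS : a \in S by apply: inS; rewrite // eq_sym sedge_neq.
  have := posS _ _ bS (geodesic_two_edges xa ab _ nexb) a.
  rewrite eq_sym bx => /(_ isT).
  by rewrite !inE aS eqxx orbT sedge_neq // => /(_ isT).
- case=> [one|off].
    (* Omitting [x] and its only non-neighbour leaves just neighbours of [x]. *)
    have /existsNP[y /not_implyP[yx /negP nexy]] := nunix.
    exists (~: [set x; y]); last by rewrite cardsCs setCK cards2 eq_sym yx.
    move=> z p; rewrite !inE negb_or => /andP[zx zy] xzp t.
    have xz : sedge x z.
      by apply: contraNT zy => nexz; apply/eqP/one.
    by rewrite (geodesic_edge xz xzp) !inE !negb_or => /and3P[-> -> _].
  (* A geodesic to a non-neighbour of [x] has one inner vertex, and [off] forces it to be the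
     omitted [u]. *)
  exists (~: [set x; u]); last by rewrite cardsCs setCK cards2 nxu.
  move=> z p; rewrite !inE negb_or => /andP[zx zu] xzp t.
  rewrite !inE negb_or => /and3P[tz tx tu].
  have [xz|nexz] := boolP (sedge x z).
    by rewrite (geodesic_edge xz xzp) !inE negb_or tx.
  rewrite eq_sym in zx.
  have [b [xb bz ->]] := geodesic_nonadjacent xu (univ z zu) zx nexz xzp.
  rewrite !inE !negb_or tx tz andbT /=; apply: contraNneq nexz => tb.
  by rewrite -tb in xb bz; apply: off bz _; rewrite // eq_sym.
Qed.

(** * From an alternative at each vertex to a uniform one, and the resulting characterization *)

Lemma nonneighbours_dichotomy u :
  universal u ->
  (forall x, at_most_one_nonneighbour x \/ no_path_to_nonneighbour_off u x) ->
  (forall x, at_most_one_nonneighbour x) \/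
  (forall x, x != u -> no_path_to_nonneighbour_off u x).
Proof.
move=> univ H.
have [?|/existsNP[x not_one]] :=
  pselect (forall x, at_most_one_nonneighbour x); first by left.
right=> y yu.
have offx : no_path_to_nonneighbour_off u x by case: (H x).
have [//|one] : no_path_to_nonneighbour_off u y \/ at_most_one_nonneighbour y.
  by case: (H y); [right|left].
have [->//|yx] := eqVneq y x.
have xu : x != u.
  by apply: contra_notN not_one => /eqP-> a b au _; rewrite univ.
have [xy|nexy] := boolP (sedge x y).
  (* The non-neighbours of x are non-neighbours of y. *)
  case: not_one => a b ax bx nexa nexb.
  have au : a != u by apply: contraNneq nexa => ->; rewrite sedge_sym univ.
  have bu : b != u by apply: contraNneq nexb => ->; rewrite sedge_sym univ.
  apply: one.
  - by apply: contraNneq nexa => ->.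
  - by apply: contraNneq nexb => ->.
  - by apply: contraNN nexa => ya; apply: offx ya ax.
  - by apply: contraNN nexb => yb; apply: offx yb bx.
(* Here x is the only non-neighbour of y. *)
move=> a b au bu ya ab by_; apply/negPn/negP => neyb.
have bx : b = x by apply: one; rewrite // 1?eq_sym // sedge_sym.
rewrite {}bx in ab.
case/negP: nexy; apply: (offx a) => //; by rewrite sedge_sym.
Qed.

Lemma vp_characterization :
  connected G -> 3 < #|G| ->
  (vp_min G = #|G| - 2 /\ vp G = #|G| - 1) <->
  exists u, [/\ universal u, exists x : G, ~ universal x &
    (forall x, at_most_one_nonneighbour x) \/
    (forall x, x != u -> no_path_to_nonneighbour_off u x)].
Proof.
move=> cG G4; have G3 := ltnW G4.
have G0 : 0 < #|G| by apply: leq_trans G4.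
have lt21 : #|G| - 2 < #|G|.-1 by rewrite -subn1 ltn_sub2l // ltnW.
split=> [[vm vM]|[u [univ [x nunix] H]]].
  have [u pu] := eq_bigmax (@position_number G) G0.
  have univ : universal u.
    by apply/(universal_position_number _ cG G3); rewrite -pu -/(vp G) vM subn1.
  exists u; split=> //.
    (* The default [#|G|] exceeds the prescribed minimum, so some vertex attains it; its position
       number is too small for a universal vertex. *)
    have [eN|[x px]] := bigmin_attained #|G| (@position_number G).
      by move: lt21; rewrite -vm /vp_min eN ltnNge leq_pred.
    exists x => /(universal_position_number _ cG G3).
    by rewrite -px -/(vp_min G) vm leqNgt lt21.
  apply: nonneighbours_dichotomy => // x.
  have [unix|nunix] := pselect (universal x).
    by left=> y z yx _; rewrite unix.
  apply/(position_number_nonuniversal cG G4 univ nunix).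
  by rewrite -vm; apply: bigmin_le.
have p_ge y : #|G| - 2 <= position_number y.
  have [uniy|nuniy] := pselect (universal y).
    by apply/(leq_trans (ltnW lt21))/(universal_position_number _ cG G3).
  apply/(position_number_nonuniversal cG G4 univ nuniy).
  case: H => [one|off]; [by left|right; apply: off].
  by apply/eqP => yu; rewrite yu in nuniy.
(* A larger position set would still have to be [[set~ y]], which has only [#|G|.-1] elements. *)
have p_le y : position_number y <= #|G|.-1.
  rewrite leqNgt; apply/negP => /leq_position_number[S posS].
  rewrite prednK // => S_ge.
  have := position_set_compl1 cG G3 posS (leq_trans (leq_pred _) S_ge).
  by move=> SE; move: S_ge; rewrite SE cardsC1 leqNgt prednK // leqnn.
split; apply/eqP; rewrite eqn_leq; apply/andP; split.
- apply: leq_trans (bigmin_le _ _ x) _.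
  rewrite -ltnS -subSn ?(ltnW G3) // subSS subn1 ltnNge.
  by apply/negP => /(universal_position_number _ cG G3).
- rewrite /vp_min.
  have [->|[y ->]] := bigmin_attained #|G| (@position_number G).
    exact: leq_subr.
  exact: p_ge.
- by rewrite subn1; apply/bigmax_leqP => y _; apply: p_le.
- rewrite subn1; apply: leq_trans (leq_bigmax u).
  exact/(universal_position_number _ cG G3).
Qed.

(** * Recognition of the two families of graphs *)

(** The deleted matching is the set of non-edges. It is nonempty because some vertex is not
    universal, and not perfect because a universal vertex is uncovered. *)
Lemma clique_minus_matchingP :
  clique_minus_matching G <->
  [/\ exists u, universal u, exists x : G, ~ universal x &
      forall x, at_most_one_nonneighbour x].
Proof.
split=> [[m [M [[Msub Mtriv] M0 Mperf [f [[g fK gK] fE]]]]]|].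
  have sE x y : sedge x y = (f x != f y) && ([set f x; f y] \notin M).
    by rewrite -fE.
  split.
  - have /existsNP[v vM] : ~ (forall v, v \in cover M).
      move=> covM; apply: Mperf; split=> //.
      by apply/setP => v; rewrite covM inE.
    exists (g v) => y yv; rewrite sE gK; apply/andP; split.
      by apply: contraNneq yv => ->; rewrite fK.
    apply/negP => vyM; apply: vM; apply/bigcupP.
    by exists [set v; f y]; rewrite // !inE eqxx.
  - have [E EM] : exists E, E \in M by apply/set0Pn/eqP.
    have /imset2P[a b _ + Eab] := subsetP Msub _ EM; rewrite inE => /andP[_ ab].
    exists (g a) => /(_ (g b)); rewrite (can_eq gK) sE !gK -Eab EM andbF.
    by rewrite eq_sym => /(_ ab).
  (* Two deleted edges at [f x] share that endpoint, so in a matching they coincide. *)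
  - move=> x y z yx zx; rewrite !sE !(inj_eq (can_inj fK)) !(eq_sym x) yx zx /=.
    rewrite !negbK => xyM xzM.
    have [xyz|/eqP nxyz] := eqVneq [set f x; f y] [set f x; f z].
      apply: (can_inj fK); apply/eqP.
      have : f y \in [set f x; f z] by rewrite -xyz !inE eqxx orbT.
      by rewrite !inE (inj_eq (can_inj fK)) (negPf yx).
    have /trivIsetP/(_ _ _ xyM xzM) := Mtriv.
    move=> /(_ (introN eqP nxyz)) /pred0P /(_ (f x)).
    by rewrite /= !inE eqxx.
case=> [[u univ] [x nunix] one].
pose h : G -> complete #|G| := enum_rank.
pose k : complete #|G| -> G := enum_val.
have hK : cancel h k := enum_rankK.
have kK : cancel k h := enum_valK.
pose M := [set [set a; b] | a in complete #|G|, b in complete #|G|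
             & (a != b) && ~~ sedge (k a) (k b)].
have MP E : reflect (exists a b : complete #|G|,
    [/\ a != b, ~~ sedge (k a) (k b) & E = [set a; b]]) (E \in M).
  apply: (iffP imset2P) => [[a b _]|[a [b [ab nab ->]]]].
    by rewrite inE => /and3P[_ ab nab] ->; exists a, b.
  by exists a b; rewrite // inE ab.
(* Any endpoint [c] of a deleted edge can be listed first; this spares the symmetric cases below. *)
have Mblock E c : E \in M -> c \in E ->
    exists d, [/\ c != d, ~~ sedge (k c) (k d) & E = [set c; d]].
  case/MP=> a [b [ab nab ->]]; rewrite !inE => /orP[]/eqP->.
    by exists b.
  by exists a; rewrite eq_sym ab sedge_sym nab setUC.
exists #|G|, M; split.
- split.
    apply/subsetP => E /MP[a [b [ab _ ->]]].
    by apply/imset2P; exists a b; rewrite // inE.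
  apply/trivIsetP => A B AM BM; apply: contraR => /pred0Pn[c /= /andP[cA cB]].
  have [d [cd ncd ->]] := Mblock _ _ AM cA.
  have [e [ce nce ->]] := Mblock _ _ BM cB.
  suff -> : d = e by [].
  apply: (can_inj kK); apply: (one (k c)) => //;
    by rewrite (can_eq kK) eq_sym.
- have /existsNP[y /not_implyP[yx /negP nexy]] := nunix.
  apply/eqP/set0Pn; exists [set h x; h y]; apply/MP.
  by exists (h x), (h y); rewrite (can_eq hK) !hK eq_sym yx.
- move=> [_ covM]; have : h u \in cover M by rewrite covM inE.
  move=> /bigcupP[E EM uE]; have [d [ud /negP[]]] := Mblock _ _ EM uE.
  by rewrite hK; apply: univ; apply: contraNneq ud => <-; rewrite kK.
- exists h; split; first by exists k.
  move=> y z; transitivity ((h y != h z) && ([set h y; h z] \notin M)) => //.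
  rewrite (can_eq hK).
  have [->|yz] /= := eqVneq y z; first by rewrite sedge_irr.
  apply/idP/idP => [|yz_e].
    apply: contraNT => nyz; apply/MP; exists (h y), (h z).
    by rewrite (can_eq hK) !hK.
  apply/negP => yzM; have /(_ (h y)) := Mblock _ _ yzM.
  rewrite !inE eqxx => /(_ isT)[d [yd nyd /setP/(_ (h z))]].
  rewrite !inE eqxx orbT (can_eq hK) eq_sym (negPf yz) /= => /esym/eqP zd.
  by rewrite -zd !hK yz_e in nyd.
Qed.

(** The vertex [u] plays the part of K_1. The cliques are the classes of the relation
    [adjacent or equal] on the other vertices, whose transitivity is the condition imposed at each
    vertex. *)
Lemma join_K1_cliquesP :
  join_K1_cliques G <->
  exists u, [/\ universal u, exists x : G, ~ universal x &
    forall x, x != u -> no_path_to_nonneighbour_off u x].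
Proof.
split=> [[r [c [r1 c0 [f [[g fK gK] fE]]]]]|[u [univ [x nunix] off]]].
  pose u := g (inl ord0).
  have fNu y : y != u -> exists t, f y = inr t.
    case fy: (f y) => [i|t]; last by exists t.
    by rewrite -(can_eq fK) gK fy (ord1 i) eqxx.
  exists u; split.
  - by move=> y yu; have [t ft] := fNu y yu; rewrite -fE gK ft.
  - pose H := join (complete 1) (disjoint_union (fun i => complete (c i))).
    pose v (i : 'I_r) : H :=
      inr (Tagged (fun i => complete (c i)) (Ordinal (c0 i))).
    pose i0 := Ordinal (ltnW r1); pose i1 := Ordinal r1.
    (* Vertices taken from two different cliques are not adjacent. *)
    exists (g (v i0)) => /(_ (g (v i1))).
    by rewrite (can_eq gK) -fE !gK => /(_ isT).
  - move=> x xu a b au bu; rewrite -!fE -(can_eq fK).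
    have [[i y] ->] := fNu x xu; have [[j z] ->] := fNu a au.
    have [[k t] ->] := fNu b bu; rewrite /sedge /= /disjoint_union_edge /=.
    case: (eqVneq i j) => //= ij; case: j / ij z => z _.
    case: (eqVneq i k) => //= ik; case: k / ik t => t _.
    by rewrite tagged_asE /= /complete_edge eq_sym; apply: contraNneq => ->.
pose R y z := (y == z) || sedge y z.
have R_equiv : {in [set~ u] & &, equivalence_rel R}.
  move=> a b d; rewrite !inE => au bu du; split; first by rewrite /R eqxx.
  case/predU1P=> [->//|ab]; rewrite /R.
  have [ad|ad] /= := eqVneq a d; first by rewrite -ad sedge_sym ab orbT.
  have [bd|bd] /= := eqVneq b d; first by rewrite -bd ab.
  rewrite eq_sym in ad; rewrite eq_sym in bd.
  apply/idP/idP => [ad_e|bd_e]; last exact: (off a au b d).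
  by apply: (off b bu a d) => //; rewrite sedge_sym.
set P := equivalence_partition R [set~ u].
have /and3P[/eqP covP tiP P0] := equivalence_partitionP R_equiv.
have inP := pblock_equivalence_partition R_equiv.
pose blk (i : 'I_#|P|) : {set G} := enum_val i.
have blkP i : blk i \in P by apply: enum_valP.
have blkNu i y : y \in blk i -> y != u.
  move=> yi; have : y \in cover P by apply/bigcupP; exists (blk i).
  by rewrite covP !inE.
(* Adjacency or equality thus reduces to comparing block indices, which serves both edge
   preservation and injectivity of [g]. *)
have blkR i j y z : y \in blk i -> z \in blk j -> R y z = (i == j).
  move=> yi zj; rewrite -inP ?inE ?(blkNu _ _ yi) ?(blkNu _ _ zj) //.
  rewrite (def_pblock tiP (blkP i) yi); apply/idP/eqP => [zi|->//].
  apply: enum_val_inj; rewrite -/(blk i) -/(blk j).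
  by rewrite -(def_pblock tiP (blkP i) zi) (def_pblock tiP (blkP j) zj).
pose H := join (complete 1) (disjoint_union (fun i => complete #|blk i|)).
pose g (t : H) : G :=
  match t with
  | inl _ => u
  | inr s => enum_val (tagged s : 'I_#|blk (tag s)|)
  end.
have gE s t : sedge (g s) (g t) = sedge s t.
  case: s t => [s|[i s]] [t|[j t]] /=.
  - by rewrite sedge_irr (ord1 s) (ord1 t).
  - by rewrite univ // (blkNu _ _ (enum_valP t)).
  - by rewrite sedge_sym univ // (blkNu _ _ (enum_valP s)).
  - rewrite /disjoint_union_edge /=.
    have := blkR _ _ _ _ (enum_valP s) (enum_valP t).
    have [ij|nij] /= := eqVneq i j; last by move/norP=> [_ /negPf].
    case: j / ij t => t; rewrite tagged_asE /= /complete_edge /R.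
    rewrite (inj_eq enum_val_inj); case: eqVneq => [->|_] //.
    by rewrite sedge_irr.
have g_inj : injective g.
  case=> [s|[i s]] [t|[j t]] /= gst.
  - by rewrite (ord1 s) (ord1 t).
  - by have := blkNu _ _ (enum_valP t); rewrite -gst eqxx.
  - by have := blkNu _ _ (enum_valP s); rewrite gst eqxx.
  - have := blkR _ _ _ _ (enum_valP s) (enum_valP t).
    rewrite gst /R eqxx /= => /esym/eqP ij; case: j / ij t gst => t gst.
    by rewrite (enum_val_inj gst).
have g_surj y : exists t, g t == y.
  have [->|yu] := eqVneq y u; first by exists (inl ord0).
  have yP : pblock P y \in P by rewrite pblock_mem // covP !inE.
  have yi : y \in blk (enum_rank_in yP (pblock P y)).
    by rewrite /blk enum_rankK_in // mem_pblock covP !inE.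
  exists (inr (Tagged (fun i => complete #|blk i|) (enum_rank_in yi y))).
  by rewrite /= enum_rankK_in.
pose f y := xchoose (g_surj y).
have fK : cancel f g by move=> y; apply/eqP/(xchooseP (g_surj y)).
exists #|P|, (fun i => #|blk i|); split.
(* A vertex and its non-neighbour lie in different blocks, so there are at least two blocks. *)
- have /existsNP[y /not_implyP[yx /negP nexy]] := nunix.
  have := nexy; rewrite -(fK x) -(fK y) gE -(can_eq fK) in yx *.
  case: (f x) yx => [s|[i s]]; case: (f y) => [t|[j t]] //=.
    by rewrite (ord1 s) (ord1 t) eqxx.
  move=> st; have [ij|nij _] := eqVneq i j.
    case: j / ij t st => t st; rewrite /sedge /= /disjoint_union_edge /=.
    rewrite eqxx tagged_asE /= /complete_edge negbK => /eqP ts.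
    by rewrite ts eqxx in st.
  case: #|P| i j nij {s t st} => [[]//|[|//]] i j.
  by rewrite (ord1 i) (ord1 j) eqxx.
- move=> i; rewrite card_gt0; apply: contraNneq P0 => <-; exact: blkP.
- exists f; split; last by move=> y z; rewrite -gE !fK.
  by exists g => // t; apply: g_inj; rewrite fK.
Qed.

End Graph.

Theorem theorem4p5 (n : nat) (hn : 4 <= n) (G : sgraph)
    (hG : connected G) (hcard : #|G| = n) :
  (vp_min G = n - 2 /\ vp G = n - 1) <->
  (clique_minus_matching G \/ join_K1_cliques G).
Proof.
rewrite -{n}hcard in hn *; rewrite vp_characterization //.
rewrite clique_minus_matchingP join_K1_cliquesP.
split=> [[u [univ nuni [one|off]]]|[[[u univ] nuni one]|[u [univ nuni off]]]].
- by left; split=> //; exists u.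
- by right; exists u.
- by exists u; split=> //; left.
- by exists u; split=> //; right.
Qed.
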